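(* Let $S_0,S_1\subset\mathbb{R}^n$ be compact sets. For $i\in\{0,1\}$, let $\rho_i(x)\,dx$ be a probability measure on the $\sigma$-field $\Sigma_i$ of Borel sets of $S_i$ that is absolutely continuous with respect to Lebesgue measure, with density $\rho_i\ge 0$. Let $q$ be an everywhere continuous, strictly positive function on $S_0\times S_1$, whose value at $(x,y)\in S_0\times S_1$ is written $q(0,x,1,y)$. Then there exist nonnegative functions $\varphi(0,\cdot),\hat\varphi(0,\cdot)$ defined on $S_0$ and $\varphi(1,\cdot),\hat\varphi(1,\cdot)$ defined on $S_1$ satisfying the system of equations $$\varphi(0,x)=\int_{S_1} q(0,x,1,y)\,\varphi(1,y)\,dy,\qquad x\in S_0,$$ $$\hat\varphi(1,x)=\int_{S_0} q(0,y,1,x)\,\hat\varphi(0,y)\,dy,\qquad x\in S_1,$$ $$\rho_0(x)=\varphi(0,x)\,\hat\varphi(0,x),\qquad x\in S_0,$$ $$\rho_1(x)=\varphi(1,x)\,\hat\varphi(1,x),\qquad x\in S_1.$$ Moreover, this solution is unique up to multiplication of $\varphi(0,\cdot)$ and $\varphi(1,\cdot)$ and division of $\hat\varphi(0,\cdot)$ and $\hat\varphi(1,\cdot)$ by the same positive constant.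
   Context: All integrals are with respect to Lebesgue measure on $\mathbb{R}^n$. Functions are real-valued and Borel measurable; as usual, densities are determined, and functions are identified, up to Lebesgue-null sets. *)

(* Defs.v *)
From HB Require Import structures.
From mathcomp Require Import all_boot all_order all_algebra.
From mathcomp Require Import all_classical all_reals all_analysis.
From mathcomp Require Import measurable_realfun.

Set Implicit Arguments.
Unset Strict Implicit.
Unset Printing Implicit Defensive.

Import Order.TTheory GRing.Theory Num.Theory.
Import numFieldTopology.Exports numFieldNormedType.Exports.

Local Open Scope classical_set_scope.
Local Open Scope ring_scope.

Section borel_rV.
Variables (R : realType) (n : nat).

HB.instance Definition _ := @isMeasurable.Build
  (sigma_display (@open 'rV[R]_n)) 'rV[R]_n <<s @open 'rV[R]_n >>
  (@sigma_algebra0 _ setT (@open 'rV[R]_n))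
  (@sigma_algebraC 'rV[R]_n (@open 'rV[R]_n))
  (@sigma_algebra_bigcup _ setT (@open 'rV[R]_n)).

Lemma open_measurable_rV (U : set 'rV[R]_n) : open U -> measurable U.
Proof. exact: sub_sigma_algebra. Qed.

Lemma measurable_coord (i : 'I_n) :
  measurable_fun [set: 'rV[R]_n] (fun v : 'rV[R]_n => v ord0 i).
Proof.
apply: (measurability _ (RGenOpens.measurableE R)) => _ [_ [a [b ->] <-]].
rewrite setTI; apply: open_measurable_rV.
apply: open_comp; last exact: interval_open.
by move=> v _; exact: coord_continuous.
Qed.

Let box (b : {ffun 'I_n -> rat} * nat) : set 'rV[R]_n :=
  [set v | forall i, ball (ratr (b.1 i) : R) b.2.+1%:R^-1 (v ord0 i)].

Let open_bigcup_box (U : set 'rV[R]_n) : open U ->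
  U = \bigcup_(b in [set b | box b `<=` U]) box b.
Proof.
move=> oU; apply/seteqP; split=> [x Ux|x [b bU bx]]; last exact: bU.
have /nbhs_ballP[e /= e0 xeU] : nbhs x U by exact: open_nbhs_nbhs.
have [k ke] : exists k : nat, k.+1%:R^-1 < e / 2.
  exists (Num.truncn ((e / 2)^-1)).
  by rewrite invf_plt ?posrE ?divr_gt0// truncnS_gt.
have /choice[a xa] (i : 'I_n) : exists q : rat,
    x ord0 i - k.+1%:R^-1 < ratr q < x ord0 i + k.+1%:R^-1.
  have [|q] := @rat_in_itvoo R (x ord0 i - k.+1%:R^-1) (x ord0 i + k.+1%:R^-1).
    by rewrite ltrD2l gtrN// invr_gt0.
  by rewrite in_itv/=; exists q.
exists ([ffun i => a i], k) => [y /= yB|i]; last first.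
  by rewrite /= ffunE /ball/= ltr_distl; exact: xa.
apply: xeU; split => // i j; rewrite ord1.
apply: (@le_ball _ _ _ (k.+1%:R^-1 + k.+1%:R^-1)).
  by rewrite [leRHS]splitr lerD// ltW.
apply: ball_triangle; last exact: yB.
apply: ball_sym; rewrite /ball/= ltr_distl ffunE; exact: xa.
Qed.

Lemma measurable_fun_rV d (T : measurableType d) (f : T -> 'rV[R]_n) :
  (forall i, measurable_fun setT (fun t => f t ord0 i)) -> measurable_fun setT f.
Proof.
move=> mf; apply: (@measurability _ _ _ _ _ f (@open 'rV[R]_n)) => // _ [U oU <-].
rewrite setTI (open_bigcup_box oU) preimage_bigcup bigcup_mkcond.
apply: countable_bigcupT_measurable; first exact: countableP.
move=> b; case: ifPn => // _.
have -> : f @^-1` box b = \bigcap_(i in [set: 'I_n])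
    ((fun t => f t ord0 i) @^-1` ball (ratr (b.1 i) : R) b.2.+1%:R^-1).
  by apply/seteqP; split=> [t fb i _|t fb i]; exact: fb.
apply: fin_bigcap_measurable => // i _; rewrite -[X in measurable X]setTI.
by apply: mf => //; exact: measurable_ball.
Qed.

Lemma measurable_rect (A : 'I_n -> set R) : (forall i, measurable (A i)) ->
  measurable [set v : 'rV[R]_n | forall i, A i (v ord0 i)].
Proof.
move=> mA; have -> : [set v : 'rV[R]_n | forall i, A i (v ord0 i)] =
    \bigcap_(i in [set: 'I_n]) ((fun v : 'rV[R]_n => v ord0 i) @^-1` A i).
  by apply/seteqP; split=> [v Av i _|v Av i]; exact: Av.
apply: fin_bigcap_measurable => // i _; rewrite -[X in measurable X]setTI.
by apply: measurable_coord => //; exact: mA.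
Qed.

End borel_rV.

Section lebesgue_rV.
Variable R : realType.

Definition rV_cons n (p : R * 'rV[R]_n) : 'rV[R]_(1 + n) :=
  row_mx (const_mx p.1 : 'rV_1) p.2.

Lemma measurable_rV_cons n :
  measurable_fun [set: measurableTypeR R * 'rV[R]_n] (@rV_cons n).
Proof.
apply: measurable_fun_rV => i; rewrite /rV_cons.
case: (split_ordP i) => j ->.
  under eq_fun do rewrite row_mxEl mxE.
  exact: measurable_fst.
under eq_fun do rewrite row_mxEr.
exact: (measurableT_comp (measurable_coord j) measurable_snd).
Qed.

(* Lebesgue measure on R^n, as a Borel measure: the unit mass at the only point
   of R^0, and on R^(n+1) the product of the measures of R and of R^n. *)
Fixpoint lebesgue_rV n : set 'rV[R]_n -> \bar R :=
  if n is m.+1 then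
    pushforward (lebesgue_measure \x^ @lebesgue_rV m)%E (@rV_cons m)
  else \d_(0 : 'rV[R]_0).

Let lebesgue_rV_measure n : exists mu : {measure set 'rV[R]_n -> \bar R},
  @lebesgue_rV n = mu :> (_ -> _).
Proof.
elim: n => [|n [mu muE]]; first by exists \d_(0 : 'rV[R]_0).
pose pi : {measure set (measurableTypeR R * 'rV[R]_n)%type -> \bar R} :=
  (lebesgue_measure \x^ mu)%E.
pose nu : {measure set 'rV[R]_(1 + n) -> \bar R} := pushforward pi (@rV_cons n).
by exists (nu (@measurable_rV_cons n)); rewrite /= muE.
Qed.

Let lebesgue_rV0 n : lebesgue_rV (set0 : set 'rV[R]_n) = 0%E.
Proof. by have [mu ->] := lebesgue_rV_measure n; exact: measure0. Qed.

Let lebesgue_rV_ge0 n (A : set 'rV[R]_n) : (0 <= lebesgue_rV A)%E.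
Proof. by have [mu ->] := lebesgue_rV_measure n; exact: measure_ge0. Qed.

Let lebesgue_rV_semi_sigma_additive n : semi_sigma_additive (@lebesgue_rV n).
Proof.
by have [mu ->] := lebesgue_rV_measure n; exact: measure_semi_sigma_additive.
Qed.

HB.instance Definition _ n := isMeasure.Build _ _ _ (@lebesgue_rV n)
  (@lebesgue_rV0 n) (@lebesgue_rV_ge0 n) (@lebesgue_rV_semi_sigma_additive n).

Lemma lebesgue_rV_rect n (A : 'I_n -> set R) :
  (forall i, measurable (A i)) ->
  lebesgue_rV [set v : 'rV[R]_n | forall i, A i (v ord0 i)] =
  (\prod_(i < n) lebesgue_measure (A i))%E.
Proof.
elim: n A => [|n IHn] A mA /=.
  by rewrite big_ord0 diracE mem_set//= => -[].
rewrite /pushforward.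
have -> : @rV_cons n @^-1` [set v | forall i, A i (v ord0 i)] =
  A ord0 `*` [set v : 'rV[R]_n | forall i, A (lift ord0 i) (v ord0 i)].
  apply/seteqP; split=> -[x v] /=.
    move=> Av; split=> [|i].
      have := Av (lshift n ord0 : 'I_(1 + n)); rewrite row_mxEl mxE.
      by congr (A _ _); exact: val_inj.
    have := Av (rshift 1 i : 'I_(1 + n)); rewrite row_mxEr.
    by congr (A _ _); exact: val_inj.
  case=> Ax Av i; case: (split_ordP (i : 'I_(1 + n))) => j ->.
    rewrite row_mxEl mxE; suff -> : lshift n j = ord0 :> 'I_n.+1 by [].
    by apply: val_inj; rewrite /= ord1.
  rewrite row_mxEr; suff -> : rshift 1 j = lift ord0 j :> 'I_n.+1 by [].
  exact: val_inj.
rewrite product_measure2E ?big_ord_recl//.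
- by congr (_ * _)%E; exact: (IHn (fun i => A (lift ord0 i))).
- exact: mA.
- by apply: (@measurable_rect R n (fun i => A (lift ord0 i))) => i; exact: mA.
Qed.

End lebesgue_rV.

Arguments lebesgue_rV {R} n _.

Section schrodinger_system.
Variables (R : realType) (n : nat).
Implicit Types (S : set 'rV[R]_n) (f : 'rV[R]_n -> R) (x y : 'rV[R]_n).

Definition probability_density S f :=
  [/\ measurable_fun S f,
      forall x, S x -> 0 <= f x &
      (\int[lebesgue_rV n]_(x in S) (f x)%:E = 1)%E].

Variables (S0 S1 : set 'rV[R]_n) (rho0 rho1 : 'rV[R]_n -> R).
Variable q : 'rV[R]_n * 'rV[R]_n -> R.
Variables phi0 hphi0 phi1 hphi1 : 'rV[R]_n -> R.

(* The integrals are extended-real valued, so that equating them with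
   real-valued functions includes their finiteness. *)
Definition schrodinger_eqs0 x :=
  (phi0 x)%:E = (\int[lebesgue_rV n]_(y in S1) (q (x, y) * phi1 y)%:E)%E /\
  rho0 x = phi0 x * hphi0 x.

Definition schrodinger_eqs1 x :=
  (hphi1 x)%:E = (\int[lebesgue_rV n]_(y in S0) (q (y, x) * hphi0 y)%:E)%E /\
  rho1 x = phi1 x * hphi1 x.

Definition schrodinger_measurable :=
  [/\ measurable_fun S0 phi0, measurable_fun S0 hphi0,
      measurable_fun S1 phi1 & measurable_fun S1 hphi1].

(* phi0, hphi0, phi1, hphi1 stand for phi(0,.), hat phi(0,.), phi(1,.),
   hat phi(1,.); only their values on S0, resp. S1, matter. *)
Definition schrodinger_solution :=
  [/\ schrodinger_measurable,
      forall x, S0 x -> [/\ 0 <= phi0 x, 0 <= hphi0 x & schrodinger_eqs0 x] &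
      forall x, S1 x -> [/\ 0 <= phi1 x, 0 <= hphi1 x & schrodinger_eqs1 x]].

(* Solutions when functions are identified up to Lebesgue-null sets. *)
Definition schrodinger_ae_solution :=
  [/\ schrodinger_measurable,
      {ae lebesgue_rV n, forall x,
        S0 x -> [/\ 0 <= phi0 x, 0 <= hphi0 x & schrodinger_eqs0 x]} &
      {ae lebesgue_rV n, forall x,
        S1 x -> [/\ 0 <= phi1 x, 0 <= hphi1 x & schrodinger_eqs1 x]}].

Lemma schrodinger_solution_ae :
  schrodinger_solution -> schrodinger_ae_solution.
Proof. by move=> [mphi eqs0 eqs1]; split=> //; exact: aeW. Qed.

End schrodinger_system.

(* Main.v *)
(* Put h = hphi1. The system says that h is a fixed point of the map S sending h
   to y |-> int q(x, y) rho0(x) / D(x) dx, with D(x) = int q(x, y) rho1(y) / h(y) dy,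
   and the three other functions are then determined by h. Compactness gives
   0 < a <= q <= b, so S is increasing and homogeneous of degree 1, and, by a
   Doeblin type estimate, contracts M / m - 1 by the factor 1 - a / b whenever
   m h1 <= h2 <= M h1. Applied to two fixed points, with m and M the infimum and
   the supremum of h2 / h1, this gives m = M. For existence iterate S from 1: by
   Fubini the rho1-average of S h / h is 1, so that m <= 1 <= M for consecutive
   iterates, which therefore converge geometrically in logarithmic scale. *)
Require Import Defs.
From HB Require Import structures.
From mathcomp Require Import all_boot all_order all_algebra.
From mathcomp Require Import all_classical all_reals all_analysis.
From mathcomp Require Import ring lra measurable_realfun.
Import Order.TTheory GRing.Theory Num.Theory.
Import numFieldTopology.Exports numFieldNormedType.Exports.
Local Open Scope classical_set_scope.
Local Open Scope ring_scope.

(** * Functions bounded above and bounded away from zero *)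

Section positive_bounded.
Context {d} {T : measurableType d} {R : realType}.
Implicit Types f g : T -> R.

(** The class in which the iteration lives: with uniform bounds on both sides, quotients of members
    are again members, so a quotient over a nonempty space has a finite supremum and a positive
    infimum. *)
Definition positive_bounded f := measurable_fun setT f /\
  exists c C, 0 < c /\ forall x, c <= f x <= C.

Definition bounded_measurable f := measurable_fun setT f /\
  exists C, forall x, `|f x| <= C.

Lemma positive_bounded_gt0 {f} x : positive_bounded f -> 0 < f x.
Proof. by move=> [_ [c [C [c0 /(_ x)/andP[cf _]]]]]; exact: lt_le_trans cf. Qed.

Lemma positive_bounded_measurable f :
  positive_bounded f -> bounded_measurable f.
Proof.
move=> pf; split; first by case: pf.
case: (pf) => _ [c [C [c0 fC]]]; exists C => x.
by rewrite gtr0_norm ?(positive_bounded_gt0 x pf)//; case/andP: (fC x).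
Qed.

Lemma bounded_measurableM f g : bounded_measurable f -> bounded_measurable g ->
  bounded_measurable (fun x => f x * g x).
Proof.
move=> [mf [C fC]] [mg [D gD]]; split; first exact: measurable_funM.
by exists (C * D) => x; rewrite normrM ler_pM.
Qed.

Lemma bounded_measurableB f g : bounded_measurable f -> bounded_measurable g ->
  bounded_measurable (fun x => f x - g x).
Proof.
move=> [mf [C fC]] [mg [D gD]]; split; first exact: measurable_funB.
exists (C + D) => x; rewrite (le_trans (ler_norm _))//.
by rewrite ger0_norm// (le_trans (ler_normB _ _))// lerD.
Qed.

Lemma bounded_measurable_cst (c : R) : bounded_measurable (fun _ : T => c).
Proof. by split; [exact: measurable_cst | exists `|c|]. Qed.

Lemma bounded_measurableZ (c : R) f : bounded_measurable f ->
  bounded_measurable (fun x => c * f x).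
Proof. by apply: bounded_measurableM; exact: bounded_measurable_cst. Qed.

Lemma positive_boundedM f g : positive_bounded f -> positive_bounded g ->
  positive_bounded (fun x => f x * g x).
Proof.
move=> pf pg; split; first by apply: measurable_funM; [case: pf|case: pg].
case: (pf) (pg) => _ [c [C [c0 fC]]] [_ [e [D [e0 gD]]]].
exists (c * e), (C * D); split=> [|x]; first exact: mulr_gt0.
have /andP[? ?] := fC x; have /andP[? ?] := gD x.
by rewrite !ler_pM ?(ltW c0) ?(ltW e0)// ltW// positive_bounded_gt0.
Qed.

Lemma positive_boundedV f : positive_bounded f ->
  positive_bounded (fun x => (f x)^-1).
Proof.
move=> pf; have f0 x := positive_bounded_gt0 x pf; split.
  rewrite (_ : (fun x => _) = expR \o (fun x => - ln (f x))).
    apply: (measurableT_comp (@measurable_expR R)).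
    apply: measurable_funN.
    by apply: (measurableT_comp (@measurable_ln R)); case: pf.
  by apply/funext => x /=; rewrite expRN lnK ?posrE.
(* On an empty [T] nothing forces [C] to be positive, hence the maximum with [c]. *)
case: (pf) => _ [c [C [c0 fC]]]; exists (Num.max c C)^-1, c^-1.
have cC0 : 0 < Num.max c C by rewrite lt_max c0.
split=> [|x]; first by rewrite invr_gt0.
have /andP[cf fCx] := fC x.
by rewrite !lef_pV2 ?posrE// cf le_max fCx orbT.
Qed.

End positive_bounded.

(** * Averages against a probability density *)

Section mean.
Context {d} {T : measurableType d} {R : realType}.
Variables (mu : {measure set T -> \bar R}) (r : T -> R).

Definition is_density := [/\ measurable_fun setT r, forall x, 0 <= r x &
  (\int[mu]_x (r x)%:E = 1)%E].

Definition mean (f : T -> R) : R := \int[mu]_x (r x * f x).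

Hypothesis dr : is_density.
Implicit Types f g : T -> R.

Lemma integrable_density : mu.-integrable setT (EFin \o r).
Proof.
case: dr => mr r0 ir; apply/integrableP; split; first exact/measurable_EFinP.
by under eq_integral do rewrite /= ger0_norm//; rewrite ir ltry.
Qed.

Lemma integrable_densityM f : bounded_measurable f ->
  mu.-integrable setT (EFin \o (fun x => r x * f x)).
Proof.
move=> [mf [C fC]]; case: (dr) => mr r0 _.
apply: (@le_integrable _ _ _ _ _ measurableT _ (fun x => (C%:E * (r x)%:E)%E)).
- by apply/measurable_EFinP; exact: measurable_funM.
- move=> x _; rewrite /= lee_fin !normrM mulrC ler_wpM2r//.
  by rewrite (le_trans (fC x))// ler_norm.
- exact: integrableZl integrable_density.
Qed.

Lemma EFin_mean f : bounded_measurable f ->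
  (mean f)%:E = (\int[mu]_x (r x * f x)%:E)%E.
Proof.
by move=> bf; rewrite fineK//; apply: integrable_fin_num; [|exact: integrable_densityM].
Qed.

Lemma mean_cst c : mean (fun=> c) = c.
Proof.
rewrite /mean; under eq_Rintegral do rewrite mulrC.
rewrite RintegralZl//; last exact: integrable_density.
by case: dr => _ _; rewrite /Rintegral => ->; rewrite mulr1.
Qed.

Lemma le_mean f g : bounded_measurable f -> bounded_measurable g ->
  (forall x, f x <= g x) -> mean f <= mean g.
Proof.
move=> bf bg fg; apply: le_Rintegral => //; try exact: integrable_densityM.
by move=> x _; rewrite ler_wpM2l//; case: dr.
Qed.

Lemma meanZ c f : bounded_measurable f -> mean (fun x => c * f x) = c * mean f.
Proof.
move=> bf; rewrite /mean; under eq_Rintegral do rewrite mulrCA.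
by rewrite RintegralZl//; exact: integrable_densityM.
Qed.

Lemma meanB f g : bounded_measurable f -> bounded_measurable g ->
  mean (fun x => f x - g x) = mean f - mean g.
Proof.
move=> bf bg; rewrite /mean; under eq_Rintegral do rewrite mulrBr.
by rewrite RintegralB//; exact: integrable_densityM.
Qed.

(** The factor [r] in the hypothesis lets [f] and [g] differ wherever the density vanishes, in
    particular off its support. *)
Lemma mean_ae_eq f g : bounded_measurable f -> bounded_measurable g ->
  {ae mu, forall x, r x * f x = r x * g x} -> mean f = mean g.
Proof.
move=> bf bg fg; apply: EFin_inj; rewrite !EFin_mean//.
apply: ae_eq_integral => //.
- exact: (measurable_int mu (integrable_densityM _ bf)).
- exact: (measurable_int mu (integrable_densityM _ bg)).
- by apply: filterS fg => x /= -> _.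
Qed.

End mean.

(** * Averages of a bounded positive kernel and their contraction property *)

Section kernel_mean.
Context {d1 d2} {X : measurableType d1} {Y : measurableType d2} {R : realType}.
Variables (mu : {sigma_finite_measure set Y -> \bar R}) (r : Y -> R).
Variables (k : X * Y -> R) (a b : R).
Hypotheses (dr : is_density mu r) (mk : measurable_fun setT k).
Hypotheses (a0 : 0 < a) (ab : a <= b) (kab : forall z, a <= k z <= b).
Implicit Types f g : Y -> R.

Definition kernel_mean f (x : X) : R := mean mu r (fun y => k (x, y) * f y).

Lemma positive_bounded_section x : positive_bounded (fun y => k (x, y)).
Proof.
split; first exact: measurableT_comp (pair1_measurable x).
by exists a, b.
Qed.

Lemma kernel_meanM f x : positive_bounded f ->
  positive_bounded (fun y => k (x, y) * f y).
Proof. by apply: positive_boundedM; exact: positive_bounded_section. Qed.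

Lemma EFin_kernel_mean f x : positive_bounded f ->
  (kernel_mean f x)%:E = (\int[mu]_y (k (x, y) * (r y * f y))%:E)%E.
Proof.
move=> pf; rewrite EFin_mean//; last exact/positive_bounded_measurable/kernel_meanM.
by apply: eq_integral => y _; rewrite mulrCA.
Qed.

(** Carrying the factor [c] covers monotonicity and, together with the reverse bound below,
    homogeneity. *)
Lemma le_kernel_mean c f g x : positive_bounded f -> positive_bounded g ->
  (forall y, c * f y <= g y) -> c * kernel_mean f x <= kernel_mean g x.
Proof.
move=> pf pg fg.
have bf := positive_bounded_measurable _ (kernel_meanM _ x pf).
have bg := positive_bounded_measurable _ (kernel_meanM _ x pg).
rewrite -meanZ//; apply: le_mean => // [|y]; first exact: bounded_measurableZ.
by rewrite mulrCA ler_wpM2l// (le_trans (ltW a0))//; case/andP: (kab (x, y)).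
Qed.

Lemma ge_kernel_mean c f g x : positive_bounded f -> positive_bounded g ->
  (forall y, g y <= c * f y) -> kernel_mean g x <= c * kernel_mean f x.
Proof.
move=> pf pg fg.
have bf := positive_bounded_measurable _ (kernel_meanM _ x pf).
have bg := positive_bounded_measurable _ (kernel_meanM _ x pg).
rewrite -meanZ//; apply: le_mean => // [|y]; first exact: bounded_measurableZ.
by rewrite mulrCA ler_wpM2l// (le_trans (ltW a0))//; case/andP: (kab (x, y)).
Qed.

(** A partial integral of a nonnegative jointly measurable function is measurable by Tonelli, which
    calls for a sigma-finite [mu]. *)
Lemma measurable_kernel_mean f : positive_bounded f ->
  measurable_fun setT (kernel_mean f).
Proof.
move=> pf; apply/measurable_EFinP.
have -> : EFin \o kernel_mean f =
    fubini_F mu (fun z => (k z * (r z.2 * f z.2))%:E).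
  by apply/funext => x /=; rewrite EFin_kernel_mean.
case: dr => mr r0 _; apply: measurable_fun_fubini_tonelli_F => [|[x y]].
  apply/measurable_EFinP; apply: measurable_funM => //.
  apply: measurable_funM; first exact: (measurableT_comp mr measurable_snd).
  by apply: (measurableT_comp _ measurable_snd); case: pf.
rewrite lee_fin !mulr_ge0//= ?ltW ?(positive_bounded_gt0 _ pf)//.
exact: positive_bounded_gt0 (positive_bounded_section x).
Qed.

Lemma kernel_mean_positive_bounded f : positive_bounded f ->
  positive_bounded (kernel_mean f).
Proof.
move=> pf; split; first exact: measurable_kernel_mean.
case: (pf) => _ [c [C [c0 fC]]]; exists (a * c), (b * C).
split=> [|x]; first exact: mulr_gt0.
have bf := positive_bounded_measurable _ (kernel_meanM _ x pf).
apply/andP; split.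
  rewrite -[leLHS](mean_cst mu r dr); apply: le_mean => // [|y].
    exact: bounded_measurable_cst.
  by rewrite ler_pM ?(ltW a0) ?(ltW c0)//; [case/andP: (kab (x, y)) | case/andP: (fC y)].
rewrite -[leRHS](mean_cst mu r dr); apply: le_mean => // [|y].
  exact: bounded_measurable_cst.
have /andP[ak kb] := kab (x, y); have /andP[cf fCy] := fC y.
by rewrite ler_pM ?(le_trans (ltW a0) ak) ?(le_trans (ltW c0) cf).
Qed.

Lemma kernel_mean_ae_eq f g : positive_bounded f -> positive_bounded g ->
  {ae mu, forall y, r y * f y = r y * g y} -> kernel_mean f = kernel_mean g.
Proof.
move=> pf pg fg; apply/funext => x; apply: mean_ae_eq => //.
- exact/positive_bounded_measurable/kernel_meanM.
- exact/positive_bounded_measurable/kernel_meanM.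
- by apply: filterS fg => y E; rewrite mulrCA E mulrCA.
Qed.

(* Doeblin: [k >= a] leaves at least the multiple [a] of [mean (g - m f)] above
   [m * kernel_mean f], while [kernel_mean f <= b * mean f]; likewise below
   [M * kernel_mean f]. *)
Lemma kernel_mean_contraction m M f g :
  positive_bounded f -> positive_bounded g -> 0 < m ->
  (forall y, m * f y <= g y <= M * f y) ->
  exists m' M', [/\ 0 < m', M' <= m' * (1 + (1 - a / b) * (M / m - 1)) &
    forall x, m' * kernel_mean f x <= kernel_mean g x <= M' * kernel_mean f x].
Proof.
move=> pf pg m0 fg.
have bf := positive_bounded_measurable _ pf.
have bg := positive_bounded_measurable _ pg.
have bmf c : bounded_measurable (fun y => c * f y) by exact: bounded_measurableZ.
set I := mean mu r f; set J := mean mu r g.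
have I0 : 0 < I.
  case: (pf) => _ [c [C [c0 fC]]]; apply: (lt_le_trans c0).
  rewrite -[leLHS](mean_cst mu r dr); apply: le_mean => //.
    exact: bounded_measurable_cst.
  by move=> y; case/andP: (fC y).
have mIJ : m * I <= J.
  by rewrite -meanZ//; apply: le_mean => // y; case/andP: (fg y).
have JMI : J <= M * I.
  by rewrite -meanZ//; apply: le_mean => // y; case/andP: (fg y).
(* The quotient of the averages lies between [m] and [M]; both bounds will be moved towards it. *)
set j := J / I.
have mj : m <= j by rewrite ler_pdivlMr.
have jM : j <= M by rewrite ler_pdivrMr.
have JE : J = j * I by rewrite /j divfK// gt_eqF.
have kf x : kernel_mean f x <= b * I.
  rewrite -meanZ//; apply: le_mean => //.
    exact/positive_bounded_measurable/kernel_meanM.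
  move=> y; rewrite ler_wpM2r//; first exact/ltW/positive_bounded_gt0.
  by case/andP: (kab (x, y)).
(* Integrate [k >= a] against the nonnegative [h - c * f]. Since [c] and [h] may have any sign, the
   choice [- M] and [- g] yields the upper estimate [up]. *)
have low c (h : Y -> R) x : bounded_measurable h -> (forall y, c * f y <= h y) ->
    a * (mean mu r h - c * I) <= mean mu r (fun y => k (x, y) * h y)
      - c * kernel_mean f x.
  move=> bh ch.
  have bk := positive_bounded_measurable _ (positive_bounded_section x).
  have bkh := bounded_measurableM _ _ bk bh.
  have bkf := bounded_measurableM _ _ bk bf.
  have bckf := bounded_measurableZ c _ bkf.
  have bhcf := bounded_measurableB _ _ bh (bmf c).
  rewrite /kernel_mean -!meanZ// -!meanB// -meanZ//.
  apply: le_mean => //.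
  - exact: bounded_measurableZ.
  - exact: bounded_measurableB.
  - move=> y; rewrite [X in _ <= _ - X]mulrCA -mulrBr ler_wpM2r ?subr_ge0//.
    by case/andP: (kab (x, y)).
have up x : a * (M * I - J) <= M * kernel_mean f x - kernel_mean g x.
  have := low (- M) (fun y => -1 * g y) x.
  rewrite meanZ// (_ : (fun y => _ * (-1 * _)) = (fun y => -1 * (k (x, y) * g y))).
    rewrite meanZ//; last exact/positive_bounded_measurable/kernel_meanM.
    rewrite -/(kernel_mean g x) -/J => up.
    have : a * (-1 * J - - M * I) <= -1 * kernel_mean g x - - M * kernel_mean f x.
      apply: up => [|y]; first exact: bounded_measurableZ.
      by rewrite !mulNr mul1r lerN2; case/andP: (fg y).
    by rewrite !mulNr !mul1r !opprK addrC [X in _ <= X]addrC.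
  by apply/funext => y; rewrite mulrCA.
have b0 : 0 < b by exact: lt_le_trans ab.
have aE c : a / b * c * (b * I) = a * (c * I) by rewrite mulrACA divfK ?gt_eqF// mulrA.
set e := a / b in aE *.
have e0 : 0 < e by rewrite divr_gt0.
(* Each bound moves towards [j] by the fraction [e = a / b]: the gain [a * (J - m * I)] equals
   [e * (j - m) * (b * I)], and [b * I] dominates [kernel_mean f x]. *)
exists (m + e * (j - m)), (M - e * (M - j)); split.
- by rewrite ltr_pwDl// mulr_ge0 ?subr_ge0// ltW.
- set p := m + e * (j - m).
  have mp : m <= p by rewrite lerDl mulr_ge0 ?subr_ge0// ltW.
  have -> : M - e * (M - j) = p + (1 - e) * (M - m) by rewrite /p; ring.
  (* The gap shrinks exactly by [1 - e]; passing from the gap to the ratio only costs the factor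
     [p / m >= 1]. *)
  have -> : p * (1 + (1 - e) * (M / m - 1)) = p + (1 - e) * (M - m) * (p / m).
    by field; rewrite gt_eqF.
  rewrite lerD2l ler_peMr//; last by rewrite ler_pdivlMr// mul1r.
  by rewrite mulr_ge0 ?subr_ge0 ?(le_trans mj)// ler_pdivrMr// mul1r.
- move=> x; have kfx := kf x; apply/andP; split.
    have lo : a * (J - m * I) <= kernel_mean g x - m * kernel_mean f x.
      by apply: low => // y; case/andP: (fg y).
    have : e * (j - m) * kernel_mean f x <= a * (J - m * I).
      by rewrite JE -mulrBl -aE ler_wpM2l// mulr_ge0 ?subr_ge0// ltW.
    by rewrite mulrDl; lra.
  have : e * (M - j) * kernel_mean f x <= a * (M * I - J).
    by rewrite JE -mulrBl -aE ler_wpM2l// mulr_ge0 ?subr_ge0// ltW.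
  by have := up x; rewrite mulrBl; lra.
Qed.

End kernel_mean.

(** * The map whose fixed points solve the system: contraction, uniqueness, existence *)

Section schrodinger_map.
Context {d0 d1} {X : measurableType d0} {Y : measurableType d1} {R : realType}.
Variables (mu0 : {sigma_finite_measure set X -> \bar R}).
Variables (mu1 : {sigma_finite_measure set Y -> \bar R}).
Variables (r0 : X -> R) (r1 : Y -> R) (q : X * Y -> R) (a b : R).
Hypotheses (dr0 : is_density mu0 r0) (dr1 : is_density mu1 r1).
Hypotheses (mq : measurable_fun setT q) (a0 : 0 < a) (ab : a <= b).
Hypothesis (qab : forall z, a <= q z <= b).
Implicit Types h : Y -> R.

(** With the variables exchanged, the second half of the map is a [kernel_mean] too. *)
Let q' (z : Y * X) : R := q (z.2, z.1).

Let mq' : measurable_fun setT q'.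
Proof. exact: (measurableT_comp mq (measurable_fun_pair measurable_snd measurable_fst)). Qed.

Let q'ab z : a <= q' z <= b. Proof. exact: qab. Qed.

Definition schrodinger_phi0 h : X -> R :=
  kernel_mean mu1 r1 q (fun y => (h y)^-1).

Definition schrodinger_map h : Y -> R :=
  kernel_mean mu0 r0 q' (fun x => (schrodinger_phi0 h x)^-1).

Local Notation D := schrodinger_phi0.
Local Notation S := schrodinger_map.

Lemma schrodinger_phi0_positive_bounded h : positive_bounded h ->
  positive_bounded (D h).
Proof.
move=> ph; apply: (kernel_mean_positive_bounded _ _ _ a b) => //.
exact: positive_boundedV.
Qed.

Lemma schrodinger_map_positive_bounded h : positive_bounded h ->
  positive_bounded (S h).
Proof.
move=> ph; apply: (kernel_mean_positive_bounded _ _ _ a b) => //.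
exact/positive_boundedV/schrodinger_phi0_positive_bounded.
Qed.

(** Each of the two inversions reverses the inequality, and the two kernel means preserve it. *)
Lemma le_schrodinger_map c h1 h2 : 0 < c ->
  positive_bounded h1 -> positive_bounded h2 ->
  (forall y, c * h1 y <= h2 y) -> forall y, c * S h1 y <= S h2 y.
Proof.
move=> c0 p1 p2 h12 y.
have pD1 := schrodinger_phi0_positive_bounded _ p1.
have pD2 := schrodinger_phi0_positive_bounded _ p2.
apply: (le_kernel_mean _ _ _ a b) => //; try exact: positive_boundedV.
move=> x; have D1 := positive_bounded_gt0 x pD1.
have D2 := positive_bounded_gt0 x pD2.
rewrite ler_pdivrMr// mulrC ler_pdivlMr// -ler_pdivlMl//.
apply: (ge_kernel_mean _ _ _ a b) => //; try exact: positive_boundedV.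
move=> {}y; have H1 := positive_bounded_gt0 y p1.
have H2 := positive_bounded_gt0 y p2.
by rewrite -invfM lef_pV2 ?posrE ?mulr_gt0.
Qed.

(** The contraction is taken from the first kernel mean alone, applied to the inverses with the
    roles of [h1] and [h2] exchanged; the second inversion exchanges them back, and the second
    kernel mean preserves the bounds. *)
Lemma schrodinger_map_contraction m M h1 h2 :
  positive_bounded h1 -> positive_bounded h2 -> 0 < m ->
  (forall y, m * h1 y <= h2 y <= M * h1 y) ->
  exists m' M', [/\ 0 < m', M' <= m' * (1 + (1 - a / b) * (M / m - 1)) &
    forall y, m' * S h1 y <= S h2 y <= M' * S h1 y].
Proof.
move=> p1 p2 m0 h12.
have pD1 := schrodinger_phi0_positive_bounded _ p1.
have pD2 := schrodinger_phi0_positive_bounded _ p2.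
have [||//||m' [M' [m'0 Mm' D12]]] := kernel_mean_contraction mu1 r1 q a b dr1 mq a0 ab qab m M
  (fun y => (h2 y)^-1) (fun y => (h1 y)^-1).
- exact: positive_boundedV.
- exact: positive_boundedV.
- move=> y; have H1 := positive_bounded_gt0 y p1.
  have H2 := positive_bounded_gt0 y p2; have /andP[mh hM] := h12 y.
  rewrite ler_pdivrMr// mulrC ler_pdivlMr// mh/=.
  by rewrite ler_pdivlMr// mulrC ler_pdivrMr.
exists m', M'; split => // y; apply/andP; split.
  apply: (le_kernel_mean _ _ _ a b) => //; try exact: positive_boundedV.
  move=> x; have D1 := positive_bounded_gt0 x pD1.
  have D2 := positive_bounded_gt0 x pD2; have /andP[mD _] := D12 x.
  by rewrite ler_pdivrMr// mulrC ler_pdivlMr.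
apply: (ge_kernel_mean _ _ _ a b) => //; try exact: positive_boundedV.
move=> x; have D1 := positive_bounded_gt0 x pD1.
have D2 := positive_bounded_gt0 x pD2; have /andP[_ mD] := D12 x.
by rewrite ler_pdivlMr// mulrC ler_pdivrMr.
Qed.

(** After exchanging the integrals, the inner one over [y] is [D h x]; it cancels the denominator
    and leaves the total mass of [r0]. *)
Lemma mean_schrodinger_map h : positive_bounded h ->
  mean mu1 r1 (fun y => S h y * (h y)^-1) = 1.
Proof.
move=> ph; have pV := positive_boundedV _ ph.
have pD := schrodinger_phi0_positive_bounded _ ph.
have pDV := positive_boundedV _ pD.
have pS := schrodinger_map_positive_bounded _ ph.
case: (dr0) (dr1) => mr0 r00 ir0 [mr1 r10 _].
have mrV : measurable_fun setT (fun y => r1 y * (h y)^-1).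
  by apply: measurable_funM => //; case: pV.
have mrDV : measurable_fun setT (fun x => r0 x * (D h x)^-1).
  by apply: measurable_funM => //; case: pDV.
apply: EFin_inj; rewrite EFin_mean//; last first.
  exact/positive_bounded_measurable/positive_boundedM.
pose F (z : X * Y) :=
  ((r1 z.2 * (h z.2)^-1) * (q z * (r0 z.1 * (D h z.1)^-1)))%:E.
transitivity (\int[mu1]_y \int[mu0]_x F (x, y))%E.
  apply: eq_integral => y _; rewrite mulrCA mulrC EFinM.
  rewrite (EFin_kernel_mean _ _ _ a b)// -ge0_integralZl_EFin//=.
  - move=> x _; rewrite lee_fin !mulr_ge0// ?ltW ?(positive_bounded_gt0 _ pDV)//.
    by rewrite (lt_le_trans a0)//; case/andP: (q'ab (y, x)).
  - apply/measurable_EFinP; apply: measurable_funM.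
      exact: (measurableT_comp mq' (pair1_measurable y)).
    exact: mrDV.
  - by rewrite mulr_ge0// ltW// (positive_bounded_gt0 y pV).
rewrite -fubini_tonelli; last 2 first.
- apply/measurable_EFinP; apply: measurable_funM.
    exact: (measurableT_comp mrV measurable_snd).
  by apply: measurable_funM => //; exact: (measurableT_comp mrDV measurable_fst).
- move=> [x y]; rewrite lee_fin !mulr_ge0//= ltW//.
  + exact: (positive_bounded_gt0 y pV).
  + by rewrite (lt_le_trans a0)//; case/andP: (qab (x, y)).
  + exact: (positive_bounded_gt0 x pDV).
rewrite -ir0; apply: eq_integral => x _.
transitivity ((r0 x * (D h x)^-1)%:E *
    \int[mu1]_y (q (x, y) * (r1 y * (h y)^-1))%:E)%E.
  rewrite -ge0_integralZl_EFin//=.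
  - by apply: eq_integral => y _; rewrite -EFinM/F/=; congr EFin; ring.
  - move=> y _; rewrite lee_fin !mulr_ge0// ?ltW ?(positive_bounded_gt0 _ pV)//.
    by rewrite (lt_le_trans a0)//; case/andP: (qab (x, y)).
  - apply/measurable_EFinP; apply: measurable_funM.
      exact: (measurableT_comp mq (pair1_measurable x)).
    exact: mrV.
  - by rewrite mulr_ge0// ltW// (positive_bounded_gt0 x pDV).
rewrite -(EFin_kernel_mean _ _ _ a b)// -EFinM -mulrA mulVf ?mulr1//.
by rewrite gt_eqF// positive_bounded_gt0.
Qed.

Lemma schrodinger_map_fixed_unique h1 h2 :
  positive_bounded h1 -> positive_bounded h2 -> S h1 = h1 -> S h2 = h2 ->
  exists2 c, 0 < c & forall y, h2 y = c * h1 y.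
Proof.
move=> p1 p2 S1 S2; pose rho y := h2 y * (h1 y)^-1.
(* The infimum and supremum below need a nonempty range. *)
have [[y0 _]|noY] := pselect (exists y : Y, True); last first.
  by exists 1 => // y; exfalso; apply: noY; exists y.
have H1 y : 0 < h1 y by exact: positive_bounded_gt0.
have [_ [c [C [c0 rhoC]]]] : positive_bounded rho.
  exact/positive_boundedM/positive_boundedV.
have rho0 : range rho !=set0 by exists (rho y0), y0.
have lbrho : has_lbound (range rho).
  by exists c => _ [y _ <-]; case/andP: (rhoC y).
have ubrho : has_ubound (range rho).
  by exists C => _ [y _ <-]; case/andP: (rhoC y).
set m := inf (range rho); set M := sup (range rho).
have cm : c <= m by apply: lb_le_inf => // _ [y _ <-]; case/andP: (rhoC y).
have m0 : 0 < m by exact: lt_le_trans cm.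
have h12 y : m * h1 y <= h2 y <= M * h1 y.
  rewrite -ler_pdivlMr//; apply/andP; split; first by apply: ge_inf => //; exists y.
  by rewrite -ler_pdivrMr//; apply: ub_le_sup => //; exists y.
(* As both functions are fixed, [m'] and [M'] bound the same quotient [h2 / h1]; [m] and [M] being
   its best bounds, [m' <= m] and [M <= M']. *)
have [m' [M' [m'0 M'm']]] := schrodinger_map_contraction m M h1 h2 p1 p2 m0 h12.
rewrite S1 S2 => h12'.
have m'm : m' <= m.
  apply: lb_le_inf => // _ [y _ <-]; rewrite ler_pdivlMr//.
  by case/andP: (h12' y).
have MM' : M <= M'.
  by apply: ge_sup => // _ [y _ <-]; rewrite ler_pdivrMr//; case/andP: (h12' y).
have b0 : 0 < b by exact: lt_le_trans ab.
have e0 : 0 < a / b by rewrite divr_gt0.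
have e1 : a / b <= 1 by rewrite ler_pdivrMr// mul1r.
have mM : m <= M.
  by have /andP[h h'] := h12 y0; rewrite -(ler_pM2r (H1 y0)) (le_trans h).
have Mm : M <= m.
  have : M <= m * (1 + (1 - a / b) * (M / m - 1)).
    rewrite (le_trans MM')// (le_trans M'm')// ler_wpM2r// addr_ge0// mulr_ge0//.
      by rewrite subr_ge0.
    by rewrite subr_ge0 ler_pdivlMr// mul1r.
  (* Thus [M <= M - (a / b) * (M - m)], which forces [M <= m]. *)
  have -> : m * (1 + (1 - a / b) * (M / m - 1)) = M - (a / b) * (M - m).
    by field; rewrite !gt_eqF.
  by rewrite lerBrDl gerDr pmulr_rle0// subr_le0.
exists m => // y; apply/eqP; rewrite eq_le andbC; have /andP[-> h] := h12 y.
by rewrite (le_trans h)// ler_wpM2r// ltW.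
Qed.

(** Iterating the contraction from the constant 1 bounds the ratio [M / m] for consecutive iterates
    by [1 + theta * lambda ^+ k]. Since [m <= 1 <= M], the ratio bound turns into bounds for [M] and
    for [1 / m] separately. *)
Lemma schrodinger_map_iter_bound :
  exists h : nat -> Y -> R, exists theta lambda : R,
  [/\ forall k, positive_bounded (h k), 0 <= theta, 0 <= lambda < 1,
      forall k, S (h k) = h k.+1 &
      forall k y, h k.+1 y <= (1 + theta * lambda ^+ k) * h k y /\
                  h k y <= (1 + theta * lambda ^+ k) * h k.+1 y].
Proof.
have b0 : 0 < b by exact: lt_le_trans ab.
have e0 : 0 < a / b by rewrite divr_gt0.
have e1 : a / b <= 1 by rewrite ler_pdivrMr// mul1r.
pose h k := iter k S (fun=> 1).
have ph k : positive_bounded (h k).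
  elim: k => [|k]; last exact: schrodinger_map_positive_bounded.
  by split; [exact: measurable_cst | exists 1, 1; split => // x; rewrite lexx].
have [_ [m0 [M0 [m00 h1]]]] := ph 1%N.
(* As [h 0] is 1, the bounds of [h 1] are those of the first quotient; the absolute value makes
   [theta] visibly nonnegative. *)
pose theta := `|M0 / m0 - 1|; pose lambda := 1 - a / b.
have l0 : 0 <= lambda by rewrite subr_ge0.
have t0 : 0 <= theta by exact: normr_ge0.
exists h, theta, lambda; split => //.
  by rewrite l0 /lambda gtrBl.
move=> k.
have tl0 : 0 <= theta * lambda ^+ k by rewrite mulr_ge0// exprn_ge0.
have [m [M [m_gt0 Mm hk]]] : exists m M, [/\ 0 < m,
    M <= m * (1 + theta * lambda ^+ k) &
    forall y, m * h k y <= h k.+1 y <= M * h k y].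
  elim: k {tl0} => [|k [m [M [m_gt0 Mm hk]]]].
    exists m0, M0; split=> [//||y]; last by rewrite !mulr1; exact: h1.
    rewrite expr0 mulr1 mulrC -ler_pdivrMr// -lerBlDl.
    exact: ler_norm.
  have [m' [M' [m'0 M'm' hk']]] :=
    schrodinger_map_contraction m M (h k) (h k.+1) (ph k) (ph k.+1) m_gt0 hk.
  exists m', M'; split => //; apply: (le_trans M'm').
  rewrite ler_pM2l// lerD2l exprS mulrCA ler_wpM2l// lerBlDl ler_pdivrMr//.
  by rewrite mulrC.
have b1 : bounded_measurable (fun y => h k.+1 y * (h k y)^-1).
  exact/positive_bounded_measurable/positive_boundedM/positive_boundedV.
have H y : 0 < h k y by exact: positive_bounded_gt0.
(* The quotient [h k.+1 / h k] has average 1, so its lower bound is at most 1 and its upper bound at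
   least 1. *)
have m1 : m <= 1.
  rewrite -[leLHS](mean_cst mu1 r1 dr1) -(mean_schrodinger_map _ (ph k)).
  apply: le_mean => // [|y]; first exact: bounded_measurable_cst.
  by rewrite ler_pdivlMr//; case/andP: (hk y).
have M1 : 1 <= M.
  rewrite -[leRHS](mean_cst mu1 r1 dr1) -(mean_schrodinger_map _ (ph k)).
  apply: le_mean => // [|y]; first exact: bounded_measurable_cst.
  by rewrite ler_pdivrMr//; case/andP: (hk y).
have tl1 : 0 < 1 + theta * lambda ^+ k by rewrite ltr_wpDr.
move=> y; have /andP[mh hM] := hk y; split.
  rewrite (le_trans hM)// ler_pM2r// (le_trans Mm)//.
  by rewrite ler_piMl// ltW.
have : (1 + theta * lambda ^+ k) * (m * h k y) <=
    (1 + theta * lambda ^+ k) * h k.+1 y by rewrite ler_pM2l.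
apply: le_trans; rewrite mulrA ler_peMl ?(ltW (H y))//.
by rewrite (le_trans M1)// (le_trans Mm)// mulrC.
Qed.

(* With [al k = exp (theta * lambda^k / (1 - lambda))] the bounds [h k / al k]
   and [al k * h k] are nested, which gives both the limit and its fixed-point
   property without any continuity of the map. *)
Lemma schrodinger_map_fixed_exists :
  exists2 h, positive_bounded h & S h = h.
Proof.
have [h [theta [lambda [ph t0 /andP[l0 l1] Sh hh]]]] := schrodinger_map_iter_bound.
have H k y : 0 < h k y by exact: positive_bounded_gt0.
have l1' : 0 < 1 - lambda by rewrite subr_gt0.
(* The exponent is the tail from [k] on of the geometric series of the [theta * lambda ^+ i], so
   [al k] dominates the product of all remaining factors [1 + theta * lambda ^+ i]. *)
pose al k := expR (theta * lambda ^+ k / (1 - lambda)).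
have al0 k : 0 < al k by exact: expR_gt0.
have al1 k : 1 <= al k.
  by rewrite -expR0 ler_expR divr_ge0 ?(ltW l1')// mulr_ge0// exprn_ge0.
have alS k : (1 + theta * lambda ^+ k) * al k.+1 <= al k.
  have -> : al k = expR (theta * lambda ^+ k) * al k.+1.
    rewrite /al -expRD; congr expR; rewrite exprS; field.
    by rewrite gt_eqF.
  by rewrite ler_pM2r// expR_ge1Dx.
have alS' k : al k.+1 <= al k.
  apply: le_trans (alS k); rewrite ler_peMl ?(ltW (al0 _))//.
  by rewrite lerDl mulr_ge0// exprn_ge0.
have low y : nondecreasing_seq (fun k => h k y / al k).
  apply/nondecreasing_seqP => k; rewrite ler_pdivrMr// mulrAC ler_pdivlMr//.
  have [_ h1] := hh k y.
  rewrite (le_trans (ler_wpM2r (ltW (al0 _)) h1))// mulrAC mulrC.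
  by rewrite ler_wpM2l// ltW.
have upp y : nonincreasing_seq (fun k => al k * h k y).
  apply/nonincreasing_seqP => k; have [h1 _] := hh k y.
  rewrite (le_trans (ler_wpM2l (ltW (al0 _)) h1))// mulrA.
  by rewrite ler_wpM2r// 1?mulrC// ltW.
(* Both sequences are compared at the common index [maxn i j], where [1 <= al] suffices. *)
have lowupp y i j : h i y / al i <= al j * h j y.
  apply: (le_trans (low y _ _ (leq_maxl i j))).
  apply: le_trans (upp y _ _ (leq_maxr i j)).
  rewrite ler_pdivrMr// mulrAC ler_peMl ?(ltW (H _ _))//.
  by rewrite mulr_ege1.
have cvg_low y : cvgn (fun k => h k y / al k).
  apply: nondecreasing_is_cvgn => //.
  by exists (al 0%N * h 0%N y) => _ [k _ <-].
pose hl y := limn (fun k => h k y / al k).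
have lowhl k y : h k y / al k <= hl y by exact: nondecreasing_cvgn_le.
have hlupp k y : hl y <= al k * h k y.
  by apply: limr_le => //; exact: nearW.
have phl : positive_bounded hl.
  split.
    apply: (@measurable_fun_cvg _ _ _ setT (fun k y => h k y / al k) hl) => [k|y _].
      by apply: measurable_funM => //; case: (ph k).
    exact: cvg_low.
  have [_ [c [C [c0 hC]]]] := ph 0%N.
  exists (c / al 0%N), (al 0%N * C); split=> [|y]; first by rewrite divr_gt0.
  have /andP[ch hCy] := hC y.
  rewrite (le_trans _ (lowhl 0%N y)) ?ler_pM2r ?invr_gt0//=.
  by rewrite (le_trans (hlupp 0%N y))// ler_pM2l.
(* Apply [S] to the two bounds of [hl] by [h k]; homogeneity takes the factor [al k] out. *)
have [SH Shl] : (forall k y, (al k)^-1 * h k.+1 y <= S hl y) /\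
    (forall k y, (al k)^-1 * S hl y <= h k.+1 y).
  split=> k y; rewrite -Sh; apply: le_schrodinger_map => //;
    rewrite ?invr_gt0// => {}y.
    by rewrite mulrC.
  by rewrite ler_pdivrMl.
(* Both [hl] and [S hl] are within a factor [al k] of [h k.+1], and [al k] tends to 1. *)
have sq k y : S hl y <= al k ^+ 2 * hl y /\ hl y <= al k ^+ 2 * S hl y.
  have hl0 := positive_bounded_gt0 y phl.
  have Shl0 := positive_bounded_gt0 y (schrodinger_map_positive_bounded _ phl).
  split.
    have := Shl k y; rewrite ler_pdivrMl// => /le_trans; apply.
    rewrite expr2 -mulrA ler_pM2l//.
    have := lowhl k.+1 y; rewrite ler_pdivrMr// mulrC => /le_trans; apply.
    by rewrite ler_pM2r.
  apply: (le_trans (hlupp k.+1 y)).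
  have := SH k y; rewrite ler_pdivrMl// => h1.
  rewrite expr2 -mulrA; apply: ler_pM => //; exact: ltW.
have alcvg : al @ \oo --> (1 : R).
  rewrite -[X in _ --> X]expR0; apply: continuous_cvg; first exact: continuous_expR.
  rewrite -[X in _ --> X](mul0r (1 - lambda)^-1); apply: cvgMl.
  by apply: cvg_geometric; rewrite ger0_norm.
have alcvg2 x : (fun k => al k ^+ 2 * x) @ \oo --> x.
  rewrite -[X in _ --> X]mul1r; apply: cvgMl.
  rewrite -[X in _ --> X](mulr1 1); exact: (cvgM alcvg alcvg).
exists hl => //; apply/funext => y; apply/eqP; rewrite eq_le; apply/andP; split.
  apply: (cvgr_to_ge (alcvg2 (hl y))).
  by apply: nearW => k; case: (sq k y).
apply: (cvgr_to_ge (alcvg2 (S hl y))).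
by apply: nearW => k; case: (sq k y).
Qed.

End schrodinger_map.

(** * Sigma-finiteness of Lebesgue measure, by exhausting the space with cubes *)

Section lebesgue_rV_sigma_finite.
Variables (R : realType) (n : nat).

Let lebesgue_rV_sigma_finite : sigma_finite setT (@lebesgue_rV R n).
Proof.
pose box (k : nat) : set 'rV[R]_n := [set v | forall i, `[- (k%:R : R), k%:R]%classic (v ord0 i)].
exists box.
  apply/esym; rewrite -subTset => v _.
  exists (Num.bound (\sum_i `|v ord0 i|)) => // i.
  rewrite /= in_itv/= -ler_norml.
  rewrite (le_trans _ (ltW (archi_boundP _)))//; last first.
    exact: sumr_ge0.
  by rewrite (bigD1 i)//= lerDl sumr_ge0.
move=> k; split.
  exact: (@measurable_rect R n (fun=> `[- (k%:R : R), k%:R]%classic)).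
rewrite [ltLHS](@lebesgue_rV_rect R n (fun=> `[- (k%:R : R), k%:R]%classic))// ltey_eq.
rewrite (big_ind (fun x => x \is a fin_num))// => [x y|_ _]; first exact: fin_numM.
by rewrite lebesgue_measure_itv/=; case: ifP.
Qed.

HB.instance Definition _ := Measure_isSigmaFinite.Build _ _ _ (@lebesgue_rV R n)
  lebesgue_rV_sigma_finite.

End lebesgue_rV_sigma_finite.

(** * Borel sets and continuous functions on the product of two Euclidean spaces *)

Section measurable_prod_rV.
Variables (R : realType) (n : nat).

(** Here [measurable] refers to the product sigma-algebra. Concatenation of rows is measurable from
    it into the Borel sets of ['rV[R]_(n + n)], and [V] is the preimage of an open set there. *)
Lemma open_measurable_prod_rV (V : set ('rV[R]_n * 'rV[R]_n)) :
  open V -> measurable V.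
Proof.
move=> oV.
pose W : set 'rV[R]_(n + n) := [set w | V (lsubmx w, rsubmx w)].
have mrow : measurable_fun setT (fun z : 'rV[R]_n * 'rV[R]_n => row_mx z.1 z.2).
  apply: measurable_fun_rV => i; case: (split_ordP i) => j ->.
    under eq_fun do rewrite row_mxEl.
    exact: (measurableT_comp (measurable_coord j) measurable_fst).
  under eq_fun do rewrite row_mxEr.
  exact: (measurableT_comp (measurable_coord j) measurable_snd).
have -> : V = setT `&` (fun z => row_mx z.1 z.2) @^-1` W.
  by rewrite setTI; apply/seteqP; split=> -[x y]; rewrite /W/= row_mxKl row_mxKr.
apply: mrow => //; apply: open_measurable_rV.
rewrite openE => w Ww.
have /nbhs_ballP[e /= e0 eV] : nbhs (lsubmx w, rsubmx w) V.
  exact: open_nbhs_nbhs.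
apply/nbhs_ballP; exists e => // w' [_ ww'].
by apply: eV; split; split => // i j; rewrite !mxE; exact: ww'.
Qed.

Lemma compact_measurable_rV (A : set 'rV[R]_n) : compact A -> measurable A.
Proof.
move=> cA; rewrite -[A]setCK; apply: measurableC; apply: open_measurable_rV.
rewrite openC; exact: compact_closed.
Qed.

Lemma within_continuous_measurable_prod_rV (A : set ('rV[R]_n * 'rV[R]_n))
    (f : 'rV[R]_n * 'rV[R]_n -> R) :
  measurable A -> {within A, continuous f} -> measurable_fun A f.
Proof.
move=> mA cf; apply: (measurability _ (RGenOpens.measurableE R)) => _ [_ [a [b ->] <-]].
have /continuousP/(_ _ (@interval_open _ (BRight a) (BLeft b) isT isT)) := cf.
move=> /open_subspaceP[V oV VE].
by rewrite setIC -VE; apply: measurableI => //; exact: open_measurable_prod_rV.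
Qed.

End measurable_prod_rV.

(** * Two-sided bounds for the potentials of an almost everywhere solution *)

Section ae_potential.
Context {d0 d1} {X : measurableType d0} {Y : measurableType d1} {R : realType}.
Variables (mu : {measure set X -> \bar R}) (nu : {measure set Y -> \bar R}).
Variables (A : set X) (k : X * Y -> R) (a b : R).
Hypotheses (mA : measurable A) (mk : measurable_fun setT k).
Hypotheses (a0 : 0 < a) (ab : a <= b) (kab : forall z, a <= k z <= b).

Lemma density_not_ae0 (rho : X -> R) : measurable_fun A rho ->
  (\int[mu]_(x in A) (rho x)%:E = 1)%E ->
  ~ {ae mu, forall x, A x -> rho x = 0}.
Proof.
move=> mrho rho1 rho0; have : (1 = 0 :> \bar R)%E; last by move=> /eqP; rewrite onee_eq0.
rewrite -rho1 -(integral0 mu A); apply: ae_eq_integral => //.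
  exact/measurable_EFinP.
by apply: filterS rho0 => x h /h ->.
Qed.

(** Almost everywhere on [A], [u] lies between [a * I] and [b * I], with [I] the integral of [f].
    The values [+oo] and 0 of [I] are excluded because either would make [rho], of mass 1, vanish
    almost everywhere on [A]. *)
Lemma ae_potential_bounds (f : Y -> R) (u g rho : X -> R) :
  measurable_fun setT f -> (forall y, 0 <= f y) ->
  measurable_fun A rho -> (\int[mu]_(x in A) (rho x)%:E = 1)%E ->
  {ae mu, forall x, A x -> (u x)%:E = (\int[nu]_y (k (x, y) * f y)%:E)%E} ->
  {ae mu, forall x, A x -> rho x = u x * g x} ->
  exists c C, 0 < c /\ {ae mu, forall x, A x -> c <= u x <= C}.
Proof.
move=> mf f0 mrho /(density_not_ae0 _ mrho) rhoN0 uE rhoE.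
have mkf x : measurable_fun setT (fun y => (k (x, y) * f y)%:E).
  apply/measurable_EFinP; apply: measurable_funM => //.
  exact: (measurableT_comp mk (pair1_measurable x)).
have mfE : measurable_fun setT (EFin \o f) by exact/measurable_EFinP.
pose I := (\int[nu]_y (f y)%:E)%E.
have I0 : (0 <= I)%E by apply: integral_ge0 => y _; rewrite lee_fin.
have k0 z : 0 <= k z by rewrite (le_trans (ltW a0))//; case/andP: (kab z).
have low x : (a%:E * I <= \int[nu]_y (k (x, y) * f y)%:E)%E.
  rewrite -ge0_integralZl_EFin ?(ltW a0)//; last first.
    by move=> y _; rewrite lee_fin.
  apply: ge0_le_integral => //.
  - by move=> y _; rewrite -EFinM lee_fin mulr_ge0// ltW.
  - exact: measurable_funeM.
  - by move=> y _; rewrite -EFinM lee_fin ler_wpM2r//; case/andP: (kab (x, y)).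
have b0 : 0 < b by exact: lt_le_trans ab.
have upp x : (\int[nu]_y (k (x, y) * f y)%:E <= b%:E * I)%E.
  rewrite -ge0_integralZl_EFin ?(ltW b0)//; last first.
    by move=> y _; rewrite lee_fin.
  apply: ge0_le_integral => //.
  - by move=> y _; rewrite lee_fin mulr_ge0.
  - exact: measurable_funeM.
  - by move=> y _; rewrite -EFinM lee_fin ler_wpM2r//; case/andP: (kab (x, y)).
have Ifin : (I < +oo)%E.
  rewrite ltNge leye_eq; apply/negP => /eqP Ioo; apply: rhoN0.
  (* The finite value [u x] cannot equal an infinite integral, so [A] would be null. *)
  apply: filterS uE => x h Ax; exfalso; have := low x.
  by rewrite -h// Ioo gt0_muley ?lte_fin// leye_eq.
have Ipos : (0 < I)%E.
  rewrite lt_neqAle I0 andbT eq_sym; apply/negP => /eqP I00; apply: rhoN0.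
  apply: filterS2 uE rhoE => x h rhox Ax; rewrite rhox//; have := low x; have := upp x.
  rewrite -h// I00 !mule0 !lee_fin => u0 u0'.
  have -> : u x = 0 by apply/eqP; rewrite eq_le u0.
  by rewrite mul0r.
have IE : I = (fine I)%:E by rewrite fineK// ge0_fin_numE.
exists (a * fine I), (b * fine I); split.
  by rewrite mulr_gt0// fine_gt0// Ipos.
apply: filterS uE => x h Ax; have := low x; have := upp x.
by rewrite -h// IE -!EFinM !lee_fin => -> ->.
Qed.

End ae_potential.

(** * Passing from integrals over a set to integrals over the whole space *)

Section restriction.
Context {d} {T : measurableType d} {R : realType}.
Variables (mu : {measure set T -> \bar R}) (S : set T).
Hypothesis mS : measurable S.

Lemma integral_kernel_restrict (k k' f g : T -> R) :
  (forall y, S y -> k y * f y = k' y * g y) -> (forall y, ~ S y -> g y = 0) ->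
  (\int[mu]_(y in S) (k y * f y)%:E = \int[mu]_y (k' y * g y)%:E)%E.
Proof.
move=> kf g0; rewrite integral_mkcond; apply: eq_integral => y _.
rewrite patchE; case: ifPn => [/set_mem Sy|/negP Sy]; first by rewrite kf.
by rewrite g0 ?mulr0// => /mem_set.
Qed.

(** An almost everywhere solution may be negative on a null set. Its positive part, extended by
    zero, has the same integrals and is nonnegative everywhere, as Tonelli-type arguments need. *)
Lemma integral_kernel_pos_part (k k' f : T -> R) :
  measurable_fun S f -> measurable_fun setT k' ->
  (forall y, S y -> k y = k' y) -> {ae mu, forall y, S y -> 0 <= f y} ->
  (\int[mu]_(y in S) (k y * f y)%:E =
   \int[mu]_y (k' y * ((fun z => Num.max (f z) 0) \_ S) y)%:E)%E.
Proof.
move=> mf mk' kk' f0.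
rewrite -(integral_kernel_restrict k' k' (fun z => Num.max (f z) 0)); last 2 first.
- by move=> y Sy; rewrite patchE mem_set.
- by move=> y Sy; rewrite patchE memNset.
have mk'S : measurable_fun S k' by exact: measurable_funTS.
have -> : (\int[mu]_(y in S) (k y * f y)%:E =
    \int[mu]_(y in S) (k' y * f y)%:E)%E.
  by apply: eq_integral => y /set_mem Sy; rewrite kk'.
apply: ae_eq_integral => //.
- by apply/measurable_EFinP; exact: measurable_funM.
- apply/measurable_EFinP; apply: measurable_funM => //.
  exact: measurable_maxr.
- by apply: filterS f0 => y h Sy; rewrite max_l// h.
Qed.

End restriction.

Lemma probability_density_nonempty (R : realType) (n : nat) (S : set 'rV[R]_n)
  (rho : 'rV[R]_n -> R) : probability_density S rho -> S !=set0.
Proof.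
move=> [_ _ rho1]; apply/set0P/eqP => S0; move: rho1.
by rewrite S0 integral_set0 => /esym/eqP; rewrite onee_eq0.
Qed.

(** * Correspondence between solutions of the system and fixed points of the map *)

Section schrodinger_fixed_point.
Variables (R : realType) (n : nat) (S0 S1 : set 'rV[R]_n).
Variables (rho0 rho1 : 'rV[R]_n -> R) (q : 'rV[R]_n * 'rV[R]_n -> R) (a b : R).
Hypotheses (mS0 : measurable S0) (mS1 : measurable S1).
Hypotheses (drho0 : probability_density S0 rho0).
Hypotheses (drho1 : probability_density S1 rho1).
Hypotheses (mq : measurable_fun (S0 `*` S1) q) (a0 : 0 < a) (ab : a <= b).
Hypothesis qab : forall z, (S0 `*` S1) z -> a <= q z <= b.

Local Notation mu := (@lebesgue_rV R n).
Let r0 := rho0 \_ S0.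
Let r1 := rho1 \_ S1.

(** Extends [q] by the constant [a], not by zero, so that the bounds [a] and [b] hold on the whole
    space. *)
Let k (z : 'rV[R]_n * 'rV[R]_n) : R := ((fun z => q z - a) \_ (S0 `*` S1)) z + a.

Let kE x y : S0 x -> S1 y -> k (x, y) = q (x, y).
Proof. by move=> Sx Sy; rewrite /k patchE mem_set// subrK. Qed.

Let mk : measurable_fun setT k.
Proof.
have mS : measurable (S0 `*` S1) by exact: measurableX.
apply: measurable_funD => //; apply/(measurable_restrictT _ mS).
exact: measurable_funB.
Qed.

Let kab z : a <= k z <= b.
Proof.
rewrite /k patchE; case: ifPn => [/set_mem/qab|_]; first by rewrite subrK.
by rewrite add0r lexx.
Qed.

Lemma density_restrict (S : set 'rV[R]_n) (rho : 'rV[R]_n -> R) :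
  measurable S -> probability_density S rho -> is_density mu (rho \_ S).
Proof.
move=> mS [mrho rho_ge0 rho1E]; split.
- exact/(measurable_restrictT _ mS).
- by move=> x; rewrite patchE; case: ifPn => // /set_mem/rho_ge0.
- rewrite -rho1E [RHS]integral_mkcond; apply: eq_integral => x _.
  by rewrite !patchE; case: ifP.
Qed.

Let dr0 : is_density mu r0. Proof. exact: density_restrict. Qed.
Let dr1 : is_density mu r1. Proof. exact: density_restrict. Qed.

Let r0E x : S0 x -> r0 x = rho0 x.
Proof. by move=> Sx; rewrite /r0 patchE mem_set. Qed.
Let r1E y : S1 y -> r1 y = rho1 y.
Proof. by move=> Sy; rewrite /r1 patchE mem_set. Qed.
Let r0N x : ~ S0 x -> r0 x = 0.
Proof. by move=> Sx; rewrite /r0 patchE memNset. Qed.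
Let r1N y : ~ S1 y -> r1 y = 0.
Proof. by move=> Sy; rewrite /r1 patchE memNset. Qed.

Local Notation D := (schrodinger_phi0 mu r1 k).
Local Notation S := (schrodinger_map mu mu r0 r1 k).

Let pD h : positive_bounded h -> positive_bounded (D h).
Proof. exact: (schrodinger_phi0_positive_bounded _ _ _ a b). Qed.
Let pS h : positive_bounded h -> positive_bounded (S h).
Proof. exact: (schrodinger_map_positive_bounded _ _ _ _ _ a b). Qed.

Let k' (z : 'rV[R]_n * 'rV[R]_n) := k (z.2, z.1).
Let mk' : measurable_fun setT k'.
Proof. exact: (measurableT_comp mk (measurable_fun_pair measurable_snd measurable_fst)). Qed.
Let k'ab z : a <= k' z <= b. Proof. exact: kab. Qed.

Let EFin_D h x : positive_bounded h ->
  (D h x)%:E = (\int[mu]_y (k (x, y) * (r1 y * (h y)^-1))%:E)%E.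
Proof.
by move=> ph; rewrite (EFin_kernel_mean _ _ _ a b)//; exact: positive_boundedV.
Qed.

Let EFin_S h y : positive_bounded h ->
  (S h y)%:E = (\int[mu]_x (k (x, y) * (r0 x * (D h x)^-1))%:E)%E.
Proof.
move=> ph; rewrite (EFin_kernel_mean _ _ k' a b)//.
exact/positive_boundedV/pD.
Qed.

(** The product equations hold by construction, the equation for [phi0] is the definition of [D h],
    and the one for [hphi1] is [S h = h]. *)
Lemma schrodinger_fixed_solution h : positive_bounded h -> S h = h ->
  schrodinger_solution S0 S1 rho0 rho1 q
    (D h) (fun x => r0 x / D h x) (fun y => r1 y / h y) h.
Proof.
move=> ph Sh; have pDh := pD _ ph.
have [[mr0 r0_ge0 _] [mr1 r1_ge0 _]] := (dr0, dr1).
have [mDV _] := positive_boundedV _ pDh; have [mhV _] := positive_boundedV _ ph.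
split.
- split; apply: measurable_funTS; [by case: pDh | | | by case: ph];
    exact: measurable_funM.
- move=> x Sx; have Dx := positive_bounded_gt0 x pDh; split.
  + exact: ltW.
  + by rewrite divr_ge0// ltW.
  + split; last by rewrite mulrC divfK ?gt_eqF// r0E.
    rewrite EFin_D//; apply/esym; apply: integral_kernel_restrict => //.
      by move=> y Sy; rewrite kE.
    by move=> y Sy; rewrite r1N// mul0r.
- move=> y Sy; have hy := positive_bounded_gt0 y ph; split.
  + by rewrite divr_ge0// ltW.
  + exact: ltW.
  + split; last by rewrite divfK ?gt_eqF// r1E.
    rewrite -[in LHS]Sh EFin_S//; apply/esym.
    apply: (integral_kernel_restrict _ _ (fun x => q (x, y)) (fun x => k (x, y))) => //.
      by move=> x Sx; rewrite kE.
    by move=> x Sx; rewrite r0N// mul0r.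
Qed.

Lemma schrodinger_solution_exists : exists phi0 hphi0 phi1 hphi1 : 'rV[R]_n -> R,
  schrodinger_solution S0 S1 rho0 rho1 q phi0 hphi0 phi1 hphi1.
Proof.
have [h ph Sh] := schrodinger_map_fixed_exists mu mu r0 r1 k a b dr0 dr1 mk a0 ab kab.
by do 4 eexists; exact: schrodinger_fixed_solution Sh.
Qed.

(** A bounded version [h0] of [hphi1] satisfies the fixed-point equation only almost everywhere on
    [S1]. One application of [S] repairs this: [D] does not see null sets, so [D (S h0) = D h0] and
    [S h0] is fixed at every point. *)
Lemma schrodinger_ae_solution_fixed phi0 hphi0 phi1 hphi1 :
  schrodinger_ae_solution S0 S1 rho0 rho1 q phi0 hphi0 phi1 hphi1 ->
  exists h, [/\ positive_bounded h, S h = h,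
    {ae mu, forall x, S0 x -> phi0 x = D h x /\ hphi0 x = r0 x / D h x} &
    {ae mu, forall y, S1 y -> phi1 y = r1 y / h y /\ hphi1 y = h y}].
Proof.
move=> [[mphi0 mhphi0 mphi1 mhphi1] eqs0 eqs1].
have [[mr0 r0_ge0 _] [mr1 r1_ge0 _]] := (dr0, dr1).
have [mrho0 rho0_ge0 rho0_1] := drho0; have [mrho1 rho1_ge0 rho1_1] := drho1.
pose f0 := (fun x => Num.max (hphi0 x) 0) \_ S0.
pose f1 := (fun y => Num.max (phi1 y) 0) \_ S1.
have mf0 : measurable_fun setT f0.
  by apply/(measurable_restrictT _ mS0); exact: measurable_maxr.
have mf1 : measurable_fun setT f1.
  by apply/(measurable_restrictT _ mS1); exact: measurable_maxr.
have f0_ge0 x : 0 <= f0 x by rewrite /f0 patchE; case: ifP; rewrite ?le_max ?lexx ?orbT.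
have hphi1E : {ae mu, forall y, S1 y ->
    (hphi1 y)%:E = (\int[mu]_x (k' (y, x) * f0 x)%:E)%E}.
  apply: filterS eqs1 => y h Sy; have [_ _ [-> _]] := h Sy.
  apply: (integral_kernel_pos_part mu S0 mS0 (fun x => q (x, y)) (fun x => k (x, y))) => //.
  - exact: (measurableT_comp mk (pair2_measurable y)).
  - by move=> x Sx; rewrite kE.
  - by apply: filterS eqs0 => x /[apply] -[].
have [c [C [c0 hC]]] : exists c C, 0 < c /\
    {ae mu, forall y, S1 y -> c <= hphi1 y <= C}.
  apply: (ae_potential_bounds mu mu S1 k' a b mS1 mk' a0 ab k'ab f0 hphi1 phi1 rho1) => //.
  by apply: filterS eqs1 => y /[apply] -[_ _ [_ ->]]; rewrite mulrC.
(* Clamping to the almost everywhere bounds makes them hold everywhere and changes [hphi1] only on a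
   null subset of [S1]. *)
pose h0 y := Num.max c (Num.min C ((hphi1 \_ S1) y)).
have ph0 : positive_bounded h0.
  split.
    apply: measurable_maxr => //; apply: measurable_minr => //.
    exact/(measurable_restrictT _ mS1).
  exists c, (Num.max c C); split=> // y.
  by rewrite /h0 le_max lexx/= ge_max !le_max lexx/= !ge_min lexx !orbT.
have pDh0 := pD _ ph0.
have h0E : {ae mu, forall y, S1 y -> h0 y = hphi1 y}.
  apply: filterS hC => y h Sy; have /andP[ch hC'] := h Sy.
  by rewrite /h0 patchE mem_set// min_r// max_r.
have f1E : {ae mu, forall y, f1 y = r1 y * (h0 y)^-1}.
  apply: filterS2 eqs1 h0E => y e h; have [Sy|Sy] := pselect (S1 y); last first.
    by rewrite r1N// mul0r /f1 patchE memNset.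
  have [p0 _ [_ rE]] := e Sy; rewrite /f1 patchE mem_set// max_l// r1E// rE -h//.
  by rewrite mulfK// gt_eqF// positive_bounded_gt0.
have phi0E : {ae mu, forall x, S0 x -> phi0 x = D h0 x}.
  apply: filterS eqs0 => x h Sx; have [_ _ [e _]] := h Sx.
  apply: EFin_inj; rewrite e EFin_D//.
  rewrite (integral_kernel_pos_part mu S1 mS1 (fun y => q (x, y)) (fun y => k (x, y)))//.
  - apply: ae_eq_integral => //.
    + apply/measurable_EFinP; apply: measurable_funM => //.
      exact: (measurableT_comp mk (pair1_measurable x)).
    + apply/measurable_EFinP; apply: measurable_funM.
        exact: (measurableT_comp mk (pair1_measurable x)).
      by apply: measurable_funM => //; case: (positive_boundedV _ ph0).
    + by apply: filterS f1E => y + _; rewrite -/f1 => ->.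
  - exact: (measurableT_comp mk (pair1_measurable x)).
  - by move=> y Sy; rewrite kE.
  - by apply: filterS eqs1 => y /[apply] -[].
have hphi0E : {ae mu, forall x, S0 x -> hphi0 x = r0 x / D h0 x}.
  apply: filterS2 eqs0 phi0E => x e h Sx; have [_ _ [_ rE]] := e Sx.
  rewrite r0E// rE h// mulrC mulrA mulVf ?mul1r// gt_eqF//.
  exact: positive_bounded_gt0.
have hphi1S : {ae mu, forall y, S1 y -> hphi1 y = S h0 y}.
  apply: filterS hphi1E => y h Sy; apply: EFin_inj; rewrite h// EFin_S//.
  have mky : measurable_fun setT (fun x => k (x, y)).
    exact: (measurableT_comp mk (pair2_measurable y)).
  apply: ae_eq_integral => //.
  - by apply/measurable_EFinP; apply: measurable_funM.
  - apply/measurable_EFinP; apply: measurable_funM => //.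
    by apply: measurable_funM => //; case: (positive_boundedV _ pDh0).
  - apply: filterS2 eqs0 hphi0E => x e hx _; congr (_ * _)%:E.
    have [Sx|Sx] := pselect (S0 x); last first.
      by rewrite r0N// mul0r /f0 patchE memNset.
    by have [_ hp _] := e Sx; rewrite /f0 patchE mem_set// max_l// hx.
have pSh0 := pS _ ph0.
(* On [S1] both arguments agree almost everywhere with [hphi1]; off [S1] the density [r1] is
   zero. *)
have DS : D (S h0) = D h0.
  apply: (kernel_mean_ae_eq _ _ _ a b) => //; try exact: positive_boundedV.
  apply: filterS2 h0E hphi1S => y e1 e2; have [Sy|Sy] := pselect (S1 y).
    by rewrite -e2// e1.
  by rewrite r1N// !mul0r.
exists (S h0); split => //.
- by rewrite {1}/schrodinger_map DS.
- by rewrite DS; apply: filterS2 phi0E hphi0E => x h h' Sx; split; [exact: h | exact: h'].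
- apply: filterS2 eqs1 hphi1S => y e h Sy; split; last exact: h.
  have [_ _ [_ rE]] := e Sy; rewrite r1E// rE h// mulfK// gt_eqF//.
  exact: positive_bounded_gt0.
Qed.

Lemma schrodinger_ae_solution_unique phi0 hphi0 phi1 hphi1 psi0 hpsi0 psi1 hpsi1 :
  schrodinger_ae_solution S0 S1 rho0 rho1 q phi0 hphi0 phi1 hphi1 ->
  schrodinger_ae_solution S0 S1 rho0 rho1 q psi0 hpsi0 psi1 hpsi1 ->
  exists2 c : R, 0 < c &
    {ae mu, forall x, S0 x -> psi0 x = c * phi0 x /\ hpsi0 x = hphi0 x / c} /\
    {ae mu, forall x, S1 x -> psi1 x = c * phi1 x /\ hpsi1 x = hphi1 x / c}.
Proof.
move=> /schrodinger_ae_solution_fixed[h [ph Sh phi0E phi1E]].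
move=> /schrodinger_ae_solution_fixed[g [pg Sg psi0E psi1E]].
have [c c0 gE] := schrodinger_map_fixed_unique mu mu r0 r1 k a b
  dr0 dr1 mk a0 ab kab h g ph pg Sh Sg.
(* The factor [c] relates the functions [hphi1], which the statement divides by its constant; hence
   the witness [c^-1]. Accordingly [D] is homogeneous of degree -1. *)
have cV0 : 0 < c^-1 by rewrite invr_gt0.
have DgE x : D g x = c^-1 * D h x.
  apply/eqP; rewrite eq_le; apply/andP; split.
    apply: (ge_kernel_mean _ _ _ a b) => //; try exact: positive_boundedV.
    by move=> y; rewrite gE invfM.
  apply: (le_kernel_mean _ _ _ a b) => //; try exact: positive_boundedV.
  by move=> y; rewrite gE invfM.
exists c^-1 => //; split.
  apply: filterS2 phi0E psi0E => x e e' Sx.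
  have [-> ->] := e Sx; have [-> ->] := e' Sx.
  by rewrite DgE invfM mulrA mulrAC.
apply: filterS2 phi1E psi1E => y e e' Sy.
have [-> ->] := e Sy; have [-> ->] := e' Sy.
by rewrite gE invrK invfM; split; [rewrite mulrCA|rewrite mulrC].
Qed.

End schrodinger_fixed_point.

(** * Existence and uniqueness for a continuous kernel on compact sets *)

Theorem proposition1 (R : realType) (n : nat) (S0 S1 : set 'rV[R]_n)
    (rho0 rho1 : 'rV[R]_n -> R) (q : 'rV[R]_n * 'rV[R]_n -> R)
    (compactS0 : compact S0) (compactS1 : compact S1)
    (density_rho0 : probability_density S0 rho0)
    (density_rho1 : probability_density S1 rho1)
    (continuous_q : {within S0 `*` S1, continuous q})
    (q_gt0 : forall x y, S0 x -> S1 y -> 0 < q (x, y)) :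
  (exists phi0 hphi0 phi1 hphi1 : 'rV[R]_n -> R,
    schrodinger_solution S0 S1 rho0 rho1 q phi0 hphi0 phi1 hphi1) /\
  (forall phi0 hphi0 phi1 hphi1 psi0 hpsi0 psi1 hpsi1 : 'rV[R]_n -> R,
    schrodinger_ae_solution S0 S1 rho0 rho1 q phi0 hphi0 phi1 hphi1 ->
    schrodinger_ae_solution S0 S1 rho0 rho1 q psi0 hpsi0 psi1 hpsi1 ->
    exists2 c : R, 0 < c &
      {ae lebesgue_rV n, forall x, S0 x ->
        psi0 x = c * phi0 x /\ hpsi0 x = hphi0 x / c} /\
      {ae lebesgue_rV n, forall x, S1 x ->
        psi1 x = c * phi1 x /\ hpsi1 x = hphi1 x / c}).
Proof.
have mS0 := compact_measurable_rV _ _ _ compactS0.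
have mS1 := compact_measurable_rV _ _ _ compactS1.
have mq : measurable_fun (S0 `*` S1) q.
  by apply: within_continuous_measurable_prod_rV => //; exact: measurableX.
have [x Sx] := probability_density_nonempty _ _ _ _ density_rho0.
have [y Sy] := probability_density_nonempty _ _ _ _ density_rho1.
(* Nonemptiness lets [q] attain its minimum and maximum on the compact product; these serve as [a]
   and [b]. *)
have S01 : S0 `*` S1 !=set0 by exists (x, y).
have cS := compact_setX compactS0 compactS1.
have [u /set_mem[Su0 Su1] qmin] := compact_EVT_min S01 cS continuous_q.
have [v _ qmax] := compact_EVT_max S01 cS continuous_q.
have qu0 : 0 < q u by move: (q_gt0 _ _ Su0 Su1); case: (u).
have quv : q u <= q v by apply: qmax; exact: mem_set.
have quvz z : (S0 `*` S1) z -> q u <= q z <= q v.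
  by move=> /mem_set Sz; rewrite qmin ?qmax.
split; last first.
  move=> phi0 hphi0 phi1 hphi1 psi0 hpsi0 psi1 hpsi1.
  exact: (schrodinger_ae_solution_unique R n S0 S1 rho0 rho1 q (q u) (q v)).
exact: (schrodinger_solution_exists R n S0 S1 rho0 rho1 q (q u) (q v)).
Qed.
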